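(* Consider the autonomous system $x_k = M x_{k-1}+w_k$, $y_k = Hx_k+v_k$ described in the context, and assume there exists a positive semi-definite solution $\widehat P=\widehat X\widehat X^{T}$ ($\widehat X\in\mathbb R^{n\times n}$) of the stable Riccati equation $$\widehat P = M\widehat X(I_n+\widehat X^{T}\Omega\widehat X)^{-1}\widehat X^{T}M^{T}+Q .$$ Let $i$ be the smallest index with $1\le i\le n_0$ such that there exists a (possibly complex) generalized eigenvector $v$ of $M^{T}$, associated to an eigenvalue of modulus $e^{\lambda_i}$, with $v\notin\mathrm{null}(Q)$. Then it is necessary that $$\frac{e^{2\lambda_i}}{1+\sigma_1^2\left(R^{-\frac12}H\widehat X\right)}<1 ,$$ where $\sigma_1$ denotes the largest singular value.
   Context: $M\in\mathbb R^{n\times n}$ is invertible, $H\in\mathbb R^{d\times n}$ with $d\le n$; $w_k,v_k$ are mutually independent, mean-zero Gaussian white sequences with covariances $Q\in\mathbb R^{n\times n}$ and $R\in\mathbb R^{d\times d}$, where $0\le q_{\inf}I_n\le Q\le q_{\sup}I_n$ and $0<r_{\inf}I_d\le R\le r_{\sup}I_d$ for real constants ($B\le A$ means $A-B$ is positive semi-definite). $\Omega=H^{T}R^{-1}H$. The Lyapunov exponents $\lambda_1>\dots>\lambda_p$ of $x_k=Mx_{k-1}$ are the logarithms of the distinct moduli of the eigenvalues of $M$ (equivalently of $M^{T}$). The index $n_0$ is defined by $\lambda_{n_0}\ge0>\lambda_{n_0+1}$, i.e. $\lambda_1,\dots,\lambda_{n_0}$ are the non-negative exponents. *)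

(* Defs.v *)
From mathcomp Require Import all_boot all_order all_algebra.
From mathcomp Require Import complex.
From mathcomp Require Import all_classical all_reals all_analysis.

Set Implicit Arguments.
Unset Strict Implicit.
Unset Printing Implicit Defensive.

Import Order.TTheory GRing.Theory Num.Theory.
Local Open Scope classical_set_scope.
Local Open Scope ring_scope.
Local Open Scope complex_scope.

(* Positive semi-definiteness includes symmetry. *)
Definition psd (R : realType) (n : nat) (A : 'M[R]_n) : Prop :=
  A^T = A /\ forall x : 'cV[R]_n, 0 <= (x^T *m A *m x) ord0 ord0.

Definition loewner_le (R : realType) (n : nat) (B A : 'M[R]_n) : Prop :=
  psd (A - B).

(* The positive semi-definite square root, which exists and is unique when [A]
   is positive semi-definite; 0 otherwise. *)
Definition sqrtmx (R : realType) (n : nat) (A : 'M[R]_n) : 'M[R]_n :=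
  xget 0 [set B | psd B /\ B *m B = A].

(* The singular values are the square roots of the eigenvalues of A^T A.  For
   m < n this lists n values instead of min(m, n), the additional ones being 0:
   the largest one is the same. *)
Definition singular_value (R : realType) (m n : nat) (A : 'M[R]_(m, n)) :
    set R :=
  [set s | 0 <= s /\ eigenvalue (A^T *m A) (s ^+ 2)].

(* The set is finite, and nonempty if 0 < n, so that the sup is a maximum. *)
Definition sigma1 (R : realType) (m n : nat) (A : 'M[R]_(m, n)) : R :=
  sup (singular_value A).

Definition cmod (R : realType) (z : R[i]) : R := Normc.normc z.

Definition cplxmx (R : realType) (m n : nat) (A : 'M[R]_(m, n)) :
    'M[R[i]]_(m, n) :=
  map_mx (real_complex R) A.

(* All complex eigenvalues, with algebraic multiplicities. *)
Definition eigenvalues (R : realType) (n : nat) (A : 'M[R]_n) : seq R[i] :=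
  sval (closed_field_poly_normal (char_poly (cplxmx A))).

Definition lyapunov_spectrum (R : realType) (n : nat) (M : 'M[R]_n) : seq R :=
  [seq ln r | r <- sort >=%R (undup [seq cmod z | z <- eigenvalues M])].

(* Indices start at 1: lambda_1 > ... > lambda_p, p = size of the spectrum. *)
Definition lyapunov (R : realType) (n : nat) (M : 'M[R]_n) (i : nat) : R :=
  nth 0 (lyapunov_spectrum M) i.-1.

(* lambda_n0 >= 0 > lambda_(n0+1), including the boundary cases n0 = 0 (no
   non-negative exponent) and n0 = p (no negative exponent). *)
Definition nonneg_exponent_index (R : realType) (n : nat) (M : 'M[R]_n)
    (n0 : nat) : Prop :=
  (n0 <= size (lyapunov_spectrum M))%N /\
  forall j, (1 <= j <= size (lyapunov_spectrum M))%N ->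
    (0 <= lyapunov M j) = (j <= n0)%N.

Definition generalized_eigenvector (R : realType) (n : nat) (A : 'M[R[i]]_n)
    (mu : R[i]) (v : 'cV[R[i]]_n) : Prop :=
  v != 0 /\ exists m : nat, (A - mu%:M) ^+ m *m v = 0.

Definition excited_exponent (R : realType) (n : nat) (M Q : 'M[R]_n)
    (i : nat) : Prop :=
  exists (mu : R[i]) (v : 'cV[R[i]]_n),
    [/\ cmod mu = expR (lyapunov M i),
        generalized_eigenvector (cplxmx M^T) mu v
      & cplxmx Q *m v != 0].

(* A random vector is the family of its components. *)
Definition rvec (R : realType) (disp : measure_display)
    (T : measurableType disp) (P : probability T R) (n : nat)
    (X : 'I_n -> {RV P >-> R}) (t : T) : 'cV[R]_n :=
  \col_i X i t.

(* [normal_prob m 0] is not a Dirac mass in the library, so the degenerate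
   Gaussian laws are listed apart. *)
Definition gaussian_law (R : realType) (mu : set R -> \bar R) : Prop :=
  exists m : R,
    (exists2 s : R, 0 < s &
       forall A : set R, measurable A -> mu A = normal_prob m s A) \/
    (forall A : set R, measurable A -> mu A = (\d_m A)%E).

Definition gaussian_vector (R : realType) (disp : measure_display)
    (T : measurableType disp) (P : probability T R) (n : nat)
    (X : 'I_n -> {RV P >-> R}) : Prop :=
  forall a : 'rV[R]_n,
    gaussian_law (pushforward P (fun t => (a *m rvec X t) ord0 ord0)).

Definition mean_zero (R : realType) (disp : measure_display)
    (T : measurableType disp) (P : probability T R) (n : nat)
    (X : 'I_n -> {RV P >-> R}) : Prop :=
  forall i, ('E_P[X i] = 0)%E.

Definition has_covariance (R : realType) (disp : measure_display)
    (T : measurableType disp) (P : probability T R) (n : nat)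
    (X : 'I_n -> {RV P >-> R}) (C : 'M[R]_n) : Prop :=
  forall i j, covariance P (X i) (X j) = (C i j)%:E.

Definition mutually_independent (R : realType) (disp : measure_display)
    (T : measurableType disp) (P : probability T R) (I : eqType)
    (F : I -> set (set T)) : Prop :=
  forall (s : seq I) (E : I -> set T), uniq s ->
    (forall i, i \in s -> F i (E i)) ->
    P (\big[setI/setT]_(i <- s) E i) = (\prod_(i <- s) P (E i))%E.

(* The sigma-algebras generated by the vectors w_k (inl k) and v_k (inr k). *)
Definition noise_sigma (R : realType) (disp : measure_display)
    (T : measurableType disp) (P : probability T R) (n d : nat)
    (w : nat -> 'I_n -> {RV P >-> R}) (v : nat -> 'I_d -> {RV P >-> R})
    (k : nat + nat) : set (set T) :=
  match k with
  | inl k => g_sigma_preimage (fun i => w k i : T -> R)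
  | inr k => g_sigma_preimage (fun i => v k i : T -> R)
  end.

(* x_k = M x_(k-1) + w_k and y_k = H x_k + v_k for k >= 1. *)
Record linear_gaussian_system (R : realType) (disp : measure_display)
    (T : measurableType disp) (P : probability T R) (n d : nat)
    (M : 'M[R]_n) (H : 'M[R]_(d, n)) (Q : 'M[R]_n) (Robs : 'M[R]_d)
    (x w : nat -> 'I_n -> {RV P >-> R}) (y v : nat -> 'I_d -> {RV P >-> R}) :
    Prop := {
  lgs_state : forall k t,
    rvec (x k.+1) t = M *m rvec (x k) t + rvec (w k.+1) t;
  lgs_obs : forall k t,
    rvec (y k.+1) t = H *m rvec (x k.+1) t + rvec (v k.+1) t;
  lgs_w_gaussian : forall k, gaussian_vector (w k);
  lgs_v_gaussian : forall k, gaussian_vector (v k);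
  lgs_w_mean : forall k, mean_zero (w k);
  lgs_v_mean : forall k, mean_zero (v k);
  lgs_w_cov : forall k, has_covariance (w k) Q;
  lgs_v_cov : forall k, has_covariance (v k) Robs;
  lgs_indep : mutually_independent P (noise_sigma w v) }.

(* The matrix Omega. *)
Definition precision (R : realType) (n d : nat) (H : 'M[R]_(d, n))
    (Robs : 'M[R]_d) : 'M[R]_n :=
  H^T *m invmx Robs *m H.

Definition stable_riccati (R : realType) (n d : nat) (M : 'M[R]_n)
    (H : 'M[R]_(d, n)) (Q : 'M[R]_n) (Robs : 'M[R]_d) (Xhat Phat : 'M[R]_n) :
    Prop :=
  Phat = M *m Xhat *m invmx (1%:M + Xhat^T *m precision H Robs *m Xhat)
           *m Xhat^T *m M^T + Q.

(* Main.v *)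
Require Import Defs.
From mathcomp Require Import all_boot all_order all_algebra.
From mathcomp Require Import complex.
From mathcomp Require Import all_classical all_reals all_analysis.
From mathcomp Require Import ring lra.

Import Order.TTheory GRing.Theory Num.Theory.
Local Open Scope classical_set_scope.
Local Open Scope ring_scope.
Local Open Scope sesquilinear_scope.

(** Write [sigma] for the largest singular value in the statement and put
    [c = 1 / (1 + sigma ^ 2)]. With [A = R^(-1/2) H X] one has
    [X^T Omega X = A^T A <= sigma ^ 2], so that [(1 + X^T Omega X)^-1 >= c]
    ([riccati_factor_ge]), and the Riccati equation for [P = X X^T] becomes a
    Lyapunov identity [P = c M P M^T + Q + E] with [E] positive semi-definite.

    Set [B = M^T], and let [mu] be an eigenvalue of [B] with [c |mu| ^ 2 >= 1].
    In the seminorm with square [x^* P x] the map [sqrt c B] is a contraction,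
    losing [x^* (Q + E) x]. A contraction cannot expand a generalized eigenvector of an
    eigenvalue of modulus at least 1, and it has no room for Jordan blocks
    there: modulo the null space of [P], each generalized eigenvector is an
    eigenvector on which the contraction is isometric
    ([nonstable_gen_eigen_null]). The loss therefore vanishes on the whole
    generalized eigenspace, hence so does [Q]
    ([generalized_eigenvector_unexcited]). So a generalized eigenvector outside
    the null space of [Q] forces [c |mu| ^ 2 < 1].

    The matrix inequalities rest on the spectral theorem for real symmetric
    matrices ([real_spectral]), which also gives the positive semi-definite
    square roots behind [sqrtmx] and the factorizations [P = Y^* Y],
    [Q + E = Z^* Z] through which the seminorms are handled. *)

(** * Contractions have no Jordan blocks at non-stable eigenvalues *)

Section NonstableContraction.
Context {C : numClosedFieldType}.

Lemma gram_ge0 {n} (x : 'cV[C]_n) : 0 <= (x ^t* *m x) 0 0.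
Proof.
by rewrite mxE sumr_ge0 // => i _; rewrite !mxE mulrC mul_conjC_ge0.
Qed.

Lemma gram_eq0 {n} (x : 'cV[C]_n) : (x ^t* *m x) 0 0 = 0 -> x = 0.
Proof.
rewrite mxE => /psumr_eq0P x0; apply/colP => i; rewrite [RHS]mxE.
apply/eqP; rewrite -mul_conjC_eq0 mulrC.
have {}x0 : (x ^t* 0 i * x i 0 = 0).
  by apply: x0 => // j _; rewrite !mxE mulrC mul_conjC_ge0.
by move: x0; rewrite !mxE => ->.
Qed.

Lemma trCmx_mul {m n p} (A : 'M[C]_(m, n)) (B : 'M[C]_(n, p)) :
  (A *m B) ^t* = B ^t* *m A ^t*.
Proof. by rewrite trmx_mul map_mxM. Qed.

Lemma trCmxZ {m n} a (A : 'M[C]_(m, n)) : (a *: A) ^t* = a^* *: A ^t*.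
Proof. by apply/matrixP => i j; rewrite !mxE rmorphM. Qed.

Context {m n p : nat} {Y : 'M[C]_(m, n)} {Z : 'M[C]_(p, n)} {B : 'M[C]_n}.
Context {mu c : C}.
Hypothesis mu_ge1 : 1 <= c * `|mu| ^+ 2.

(** [sqrt c B] contracts the seminorm [|Y x|], and [|Z x| ^ 2] measures the
    loss; an identity of matrices encodes this for all pairs of vectors at
    once. *)
Hypothesis YZE : Y ^t* *m Y = c *: (B ^t* *m (Y ^t* *m Y) *m B) + Z ^t* *m Z.

Lemma gram_split (u v : 'cV[C]_n) :
  (Y *m u) ^t* *m (Y *m v) =
  c *: ((Y *m B *m u) ^t* *m (Y *m B *m v)) + (Z *m u) ^t* *m (Z *m v).
Proof.
rewrite !trCmx_mul !mulmxA -(mulmxA _ _ Y) YZE mulmxDr mulmxDl.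
by rewrite -scalemxAr -scalemxAl !mulmxA.
Qed.

(** Comparing [|Y u| ^ 2] with [c |Y B u| ^ 2 = c |mu| ^ 2 |Y u| ^ 2] leaves the
    nonnegative quantities [(c |mu| ^ 2 - 1) |Y u| ^ 2] and [|Z u| ^ 2] with sum
    zero. *)
Lemma eigen_mod_null (u : 'cV[C]_n) : Y *m B *m u = mu *: (Y *m u) ->
  (c * `|mu| ^+ 2 - 1) * ((Y *m u) ^t* *m (Y *m u)) 0 0 = 0 /\ Z *m u = 0.
Proof.
move=> YBu; have := gram_split u u; rewrite YBu.
move=> /(congr1 (fun M : 'M[C]_1 => M 0 0)).
rewrite trCmxZ -scalemxAl -scalemxAr !scalerA [in RHS]mxE.
rewrite [X in _ = X + _]mxE -(mulrA c) -normCKC => split_u.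
set N := ((Y *m u) ^t* *m (Y *m u)) 0 0 in split_u *.
have N_ge0 : 0 <= N := gram_ge0 _.
have Z_ge0 := gram_ge0 (Z *m u).
have prod_ge0 : 0 <= (c * `|mu| ^+ 2 - 1) * N by rewrite mulr_ge0 // subr_ge0.
have sum0 : (c * `|mu| ^+ 2 - 1) * N + ((Z *m u) ^t* *m (Z *m u)) 0 0 = 0.
  by rewrite mulrBl mul1r {2}split_u opprD addrA subrK subrr.
move/eqP: sum0; rewrite paddr_eq0 // => /andP[/eqP ? /eqP /gram_eq0 ?].
by split.
Qed.

(** Induction on the order [k]. By induction [u = (B - mu) v] is an eigenvector
    modulo the kernel of [Y], so that [Z u = 0], and pairing [u] with [v] in the
    contraction identity gives [c mu^* |Y u| ^ 2 = (1 - c |mu| ^ 2) <Y u, Y v>].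
    Either [c |mu| ^ 2 <> 1], and [Y u = 0] by [eigen_mod_null], or the
    right-hand side vanishes, and [Y u = 0] again; thus [v] too is an
    eigenvector modulo the kernel of [Y]. *)
Lemma nonstable_gen_eigen_null k (v : 'cV[C]_n) :
  (B - mu%:M) ^+ k *m v = 0 -> Y *m B *m v = mu *: (Y *m v).
Proof.
elim: k v => [|k IHk] v.
  by rewrite expr0 mul1mx => ->; rewrite !mulmx0 scaler0.
set u := (B - mu%:M) *m v.
have -> : (B - mu%:M) ^+ k.+1 *m v = (B - mu%:M) ^+ k *m u.
  by rewrite exprSr -[LHS]mulmxA.
move=> /IHk YBu.
have Bv : B *m v = mu *: v + u by rewrite /u mulmxBl mul_scalar_mx addrC subrK.
have [Yu0 Zu0] := eigen_mod_null _ YBu.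
have := gram_split u v.
rewrite Zu0 trmx0 map_mx0 mul0mx addr0 YBu -!mulmxA Bv mulmxDr -scalemxAr.
rewrite trCmxZ mulmxDr -!scalemxAl -!scalemxAr.
move=> /(congr1 (fun M : 'M[C]_1 => M 0 0)).
set N := (Y *m u) ^t* *m (Y *m u); set W := (Y *m u) ^t* *m (Y *m v).
move=> split_uv.
suff N0 : N 0 0 = 0 by rewrite (gram_eq0 _ N0) addr0.
move: Yu0 split_uv; rewrite -/N; clearbody N W; rewrite !mxE => Yu0 split_uv.
have mu_neq0 : mu != 0.
  by apply: contraTneq mu_ge1 => ->; rewrite normr0 expr0n mulr0 ler10.
have c_neq0 : c != 0 by apply: contraTneq mu_ge1 => ->; rewrite mul0r ler10.
have N0 : c * mu^* * N 0 0 = (1 - c * `|mu| ^+ 2) * W 0 0.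
  by rewrite normCK mulrBl mul1r {1}split_uv; ring.
move/eqP: Yu0; rewrite mulf_eq0 => /orP[|/eqP//].
rewrite subr_eq0 => /eqP cmu1; move/eqP: N0.
rewrite cmu1 subrr mul0r !mulf_eq0 conjC_eq0.
by rewrite (negPf mu_neq0) (negPf c_neq0) => /eqP.
Qed.

Lemma nonstable_gen_eigen_unexcited k (v : 'cV[C]_n) :
  (B - mu%:M) ^+ k *m v = 0 -> Z *m v = 0.
Proof. by move/nonstable_gen_eigen_null/eigen_mod_null => []. Qed.

End NonstableContraction.

(** * The spectral theorem for real symmetric matrices *)

Section RealSpectral.
Context {R : rcfType}.

Lemma normsq_gt0 {n} (v : 'rV[R]_n) : v != 0 -> 0 < (v *m v^T) 0 0.
Proof.
rewrite lt_neqAle mxE => v0; apply/andP; split; last first.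
  by apply: sumr_ge0 => i _; rewrite !mxE -expr2 sqr_ge0.
apply: contraNneq v0 => /esym /psumr_eq0P h; apply/eqP/rowP => i.
have := h (fun j _ => _) i isT; rewrite !mxE -expr2 => /(_ _)/eqP.
rewrite expf_eq0 /= => h1; apply/eqP/h1 => j.
by rewrite mxE -expr2 sqr_ge0.
Qed.

(** A complex eigenvalue [a] exists, and it is real because [a v v^* = v A v^*]
    is its own conjugate; a real eigenvalue of a real matrix has a real
    eigenvector. *)
Lemma symmetric_eigenvector {n} (A : 'M[R]_n.+1) : A^T = A ->
  exists a (v : 'rV[R]_n.+1), v *m A = a *: v /\ (v *m v^T) 0 0 = 1.
Proof.
move=> Asym.
have [a ea] := eigenvalue_closed (map_mx (real_complex R) A) (ltn0Sn n).
have [v vA v0] := eigenvalueP ea.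
have a_real : a^*%C = a.
  have Aherm : (map_mx (real_complex R) A) ^t* = map_mx (real_complex R) A.
    apply/matrixP => i j; rewrite !mxE -[in RHS]Asym mxE; exact: conjc_real.
  have N0 : (v *m v ^t*) 0 0 != 0.
    rewrite -dotmxE; by rewrite dnorm_eq0.
  apply: (mulIf N0).
  have : (v *m map_mx (real_complex R) A *m v ^t*) ^t* =
      v *m map_mx (real_complex R) A *m v ^t*.
    rewrite !trmx_mul !map_mxM map_trmx trmxK -map_mx_comp.
    by rewrite (map_mx_id (@conjCK _)) Aherm mulmxA.
  rewrite vA -scalemxAl => /(congr1 (fun M : 'M[R[i]]_1 => M 0 0)).
  rewrite !mxE rmorphM; congr (_ * _ = _).
  rewrite rmorph_sum; apply: eq_bigr => i _; rewrite !mxE rmorphM mulrC.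
  by congr (_ * _); exact: conjCK.
have [r aE] : exists r : R, a = r%:C%C.
  exists (complex.Re a); case: a a_real {ea vA} => x y [] /= yN.
  by congr Complex; lra.
have {ea} : eigenvalue A r by move: ea; rewrite aE eigenvalue_map.
case/eigenvalueP => w wA w0; exists r, ((Num.sqrt ((w *m w^T) 0 0))^-1 *: w).
have w_gt0 := normsq_gt0 w w0.
split; first by rewrite -scalemxAl wA !scalerA mulrC.
rewrite linearZ /= -scalemxAl -scalemxAr scalerA mxE -invfM -expr2.
by rewrite sqr_sqrtr ?ltW // mulVf // gt_eqF.
Qed.

(** The Householder reflection along [w = v - e_0] exchanges [e_0] and [v]; it
    is undefined for [v = e_0], where the identity serves. *)
Lemma orthogonal_first_row {n} (v : 'rV[R]_n.+1) : (v *m v^T) 0 0 = 1 ->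
  exists V : 'M[R]_n.+1, V *m V^T = 1%:M /\ delta_mx 0 0 *m V = v.
Proof.
move=> v1; pose e : 'rV[R]_n.+1 := delta_mx 0 0; pose w := v - e.
have [w0|w_neq0] := eqVneq w 0.
  exists 1%:M; rewrite trmx1 !mulmx1; split=> //; apply/eqP.
  by rewrite eq_sym -subr_eq0 -/e -/w w0.
pose N := (w *m w^T) 0 0; pose K := w^T *m w; pose V := 1%:M - (2 / N) *: K.
have N_neq0 : N != 0 by rewrite gt_eqF // normsq_gt0.
have VT : V^T = V by rewrite /V linearB /= linearZ /= trmx1 /K trmx_mul trmxK.
have ee : (e *m e^T) 0 0 = 1 by rewrite /e trmx_delta mul_delta_mx mxE.
have ve : (v *m e^T) 0 0 = (e *m v^T) 0 0.
  by rewrite -[v *m _]trmxK trmx_mul trmxK mxE.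
have NE : N = -2 * (e *m w^T) 0 0.
  rewrite /N /w linearB /= !mulmxBl !mulmxBr; rewrite !mxE in v1 ee ve *.
  by rewrite v1 ee ve; ring.
have mx1 (M : 'M[R]_1) : M = (M 0 0)%:M by rewrite -mx11_scalar.
exists V; rewrite VT; split.
  have KK : K *m K = N *: K.
    rewrite /K mulmxA -(mulmxA _ w) (mx1 (w *m w^T)) mul_mx_scalar.
    by rewrite -scalemxAl.
  rewrite /V mulmxBl mul1mx mulmxBr mulmx1.
  rewrite -scalemxAl -scalemxAr KK !scalerA.
  rewrite opprB addrA -addrA -scalerBl -[RHS]addr0 -addrA -scaleNr -scalerDl.
  congr (_ + _); apply/eqP; rewrite scaler_eq0; apply/orP; left; apply/eqP.
  by field.
rewrite -/e /V mulmxBr mulmx1 -scalemxAr mulmxA (mx1 (e *m w^T)).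
rewrite mul_scalar_mx scalerA.
have -> : 2 / N * (e *m w^T) 0 0 = -1.
  have : (e *m w^T) 0 0 != 0.
    by apply: contraNneq N_neq0 => h; rewrite NE h mulr0.
  by rewrite NE => h; field.
by rewrite scaleN1r opprK /w addrC subrK.
Qed.

(** Induction on the size: an orthogonal [V] whose first row is a unit
    eigenvector turns [A] into the block diagonal matrix [B], and the induction
    hypothesis diagonalizes its lower right block. *)
Theorem real_spectral {n} (A : 'M[R]_n) : A^T = A ->
  exists (U : 'M[R]_n) (D : 'rV[R]_n),
    U *m U^T = 1%:M /\ A = U^T *m diag_mx D *m U.
Proof.
elim: n A => [|n IHn] A Asym.
  by exists 0, 0; split; apply/matrixP; case.
have [a [v [vA v1]]] := symmetric_eigenvector A Asym.
have [V [VV Vv]] := orthogonal_first_row v v1.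
have V'V : V^T *m V = 1%:M by apply: mulmx1C.
pose B : 'M[R]_(1 + n) := V *m A *m V^T.
have Bsym : B^T = B by rewrite /B !trmx_mul trmxK Asym mulmxA.
have Bur : ursubmx B = 0.
  apply/matrixP => i j; rewrite mxE mxE ord1.
  have -> : B (lshift n 0) (rshift 1 j) =
      (delta_mx 0 0 *m B : 'rV[R]_(1 + n)) 0 (rshift 1 j).
    by rewrite -rowE [RHS]mxE; congr (fun_of_matrix B _ _); apply: val_inj.
  rewrite /B !mulmxA Vv vA -scalemxAl -Vv -mulmxA VV mulmx1 !mxE /=.
  by rewrite mulr0.
have Bdl : dlsubmx B = 0 by rewrite -[B]Bsym -trmx_ursub Bur trmx0.
have [|U [D [UU BE]]] := IHn (drsubmx B); first by rewrite trmx_drsub Bsym.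
have B_block : B = block_mx (ulsubmx B) 0 0 (U^T *m diag_mx D *m U).
  by rewrite -[LHS]submxK Bur Bdl BE.
pose W : 'M[R]_(1 + n) := block_mx 1%:M 0 0 U.
pose E : 'rV[R]_(1 + n) := row_mx (const_mx (B 0 0)) D.
have WW : W *m W^T = 1%:M.
  rewrite tr_block_mx !trmx0 trmx1 mulmx_block !mulmx0 !mul0mx !addr0 add0r.
  by rewrite UU mul1mx -scalar_mx_block.
have BW : B = W^T *m diag_mx E *m W.
  rewrite B_block diag_mx_row tr_block_mx !trmx0 trmx1 !mulmx_block.
  rewrite !(mulmx0, mul0mx, mulmx1, mul1mx, addr0, add0r).
  congr block_mx; apply/matrixP => i j; rewrite !ord1.
  rewrite 2![LHS]mxE [RHS]mxE /= mulr1n [RHS]mxE.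
  by congr (fun_of_matrix B _ _); apply: val_inj.
exists (W *m V), E; split; rewrite trmx_mul.
  by rewrite -mulmxA (mulmxA V) VV mul1mx.
rewrite -!mulmxA (mulmxA W^T) (mulmxA _ W) -BW.
by rewrite /B !mulmxA V'V mul1mx -mulmxA V'V mulmx1.
Qed.

End RealSpectral.

(** * Positive semi-definite matrices *)

Section PSD.
Context {R : realType}.

Lemma quad_diag {n} (D : 'rV[R]_n) (y : 'cV[R]_n) :
  (y^T *m diag_mx D *m y) 0 0 = \sum_i D 0 i * y i 0 ^+ 2.
Proof.
rewrite -mulmxA mul_diag_mx mxE; apply: eq_bigr => i _; rewrite !mxE.
by rewrite expr2 mulrCA.
Qed.

Lemma psd_diag {n} (D : 'rV[R]_n) : (forall i, 0 <= D 0 i) -> psd (diag_mx D).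
Proof.
move=> D_ge0; split=> [|x]; first exact: tr_diag_mx.
by rewrite quad_diag sumr_ge0 // => i _; rewrite mulr_ge0 ?sqr_ge0.
Qed.

Lemma psd_congr {m n} (A : 'M[R]_n) (Y : 'M[R]_(m, n)) :
  psd A -> psd (Y *m A *m Y^T).
Proof.
move=> [Asym A_ge0]; split=> [|x]; first by rewrite !trmx_mul trmxK Asym mulmxA.
by have := A_ge0 (Y^T *m x); rewrite trmx_mul trmxK !mulmxA.
Qed.

Lemma psdD {n} (A B : 'M[R]_n) : psd A -> psd B -> psd (A + B).
Proof.
move=> [Asym A_ge0] [Bsym B_ge0]; split=> [|x].
  by rewrite linearD /= Asym Bsym.
by rewrite mulmxDr mulmxDl mxE addr_ge0.
Qed.

Lemma psd_scalar {n} (a : R) : 0 <= a -> psd (a%:M : 'M[R]_n).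
Proof.
by move=> a_ge0; rewrite -diag_const_mx; apply: psd_diag => i; rewrite mxE.
Qed.

Lemma psd_gram {m n} (A : 'M[R]_(m, n)) : psd (A^T *m A).
Proof.
have /(psd_congr _ A^T) : psd (1%:M : 'M[R]_m) by exact: psd_scalar.
by rewrite mulmx1 trmxK.
Qed.

Lemma psd_spectral {n} (A : 'M[R]_n) : psd A ->
  exists (U : 'M[R]_n) (D : 'rV[R]_n),
    [/\ U *m U^T = 1%:M, forall i, 0 <= D 0 i & A = U^T *m diag_mx D *m U].
Proof.
move=> Apsd; have [U [D [UU AE]]] := real_spectral A (proj1 Apsd).
exists U, D; split=> // i; have [_] := psd_congr _ U Apsd.
have -> : U *m A *m U^T = diag_mx D.
  by rewrite AE !mulmxA UU mul1mx -mulmxA UU mulmx1.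
move=> /(_ (delta_mx i 0)); rewrite quad_diag.
rewrite (bigD1 i) //= big1 => [|j /negPf ji].
  by rewrite addr0 mxE !eqxx expr1n mulr1.
by rewrite mxE ji expr0n mulr0.
Qed.

Lemma spectral_eigenvalue {n} (U : 'M[R]_n) (D : 'rV[R]_n) a :
  U *m U^T = 1%:M ->
  eigenvalue (U^T *m diag_mx D *m U) a <-> exists i, a = D 0 i.
Proof.
move=> UU; have U'U : U^T *m U = 1%:M by apply: mulmx1C.
split=> [/eigenvalueP[v vA v0]|[i ->]].
  have wD : (v *m U^T) *m diag_mx D = a *: (v *m U^T).
    by rewrite scalemxAl -vA -!mulmxA UU mulmx1.
  have : v *m U^T != 0.
    by apply: contraNneq v0 => w0; rewrite -[v]mulmx1 -U'U mulmxA w0 mul0mx.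
  move: (v *m U^T) wD => w wD /rV0Pn[i wi]; exists i; apply: (mulIf wi).
  by move: wD; rewrite mul_mx_diag => /rowP /(_ i); rewrite !mxE mulrC.
apply/eigenvalueP; exists (row i U).
  by rewrite -row_mul !mulmxA UU mul1mx row_mul row_diag_mx -scalemxAl -rowE.
apply: contraTneq (oner_neq0 R) => Ui0; rewrite negbK.
have := row_mul i U U^T; rewrite UU Ui0 mul0mx => /rowP/(_ i).
by rewrite !mxE eqxx => /eqP.
Qed.

Lemma psd_sqrt_exists {n} (A : 'M[R]_n) : psd A ->
  exists B : 'M[R]_n, psd B /\ B *m B = A.
Proof.
move=> /psd_spectral[U [D [UU D_ge0 ->]]].
pose S : 'rV[R]_n := \row_i Num.sqrt (D 0 i).
exists (U^T *m diag_mx S *m U); split.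
  have /(psd_congr _ U^T) : psd (diag_mx S).
    by apply: psd_diag => i; rewrite mxE sqrtr_ge0.
  by rewrite trmxK.
rewrite !mulmxA -(mulmxA _ U) UU mulmx1 -(mulmxA _ _ (diag_mx _)).
rewrite mulmx_diag; congr (_ *m diag_mx _ *m _).
by apply/rowP => i; rewrite !mxE -expr2 sqr_sqrtr.
Qed.

Lemma sqrtmxP {n} (A : 'M[R]_n) : psd A ->
  psd (sqrtmx A) /\ sqrtmx A *m sqrtmx A = A.
Proof. by move=> /psd_sqrt_exists; exact: xgetPex. Qed.

(** [sigma1] is a supremum, so that this bound needs the set of singular values
    to be bounded: their squares are among the finitely many spectral values. *)
Lemma eigenvalue_gram_le {m n} (A : 'M[R]_(m, n)) a :
  eigenvalue (A^T *m A) a -> a <= sigma1 A ^+ 2.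
Proof.
have [U [D [UU D_ge0 AE]]] := psd_spectral _ (psd_gram A).
move=> ea; have a_ge0 : 0 <= a.
  by move: ea; rewrite AE => /(spectral_eigenvalue _ _ _ UU)[i ->].
suff sqrt_le : Num.sqrt a <= sigma1 A.
  by rewrite -[leLHS]sqr_sqrtr // lerXn2r ?nnegrE ?(le_trans _ sqrt_le).
apply: sup_upper_bound; last by split; rewrite ?sqrtr_ge0 ?sqr_sqrtr.
split; first by exists (Num.sqrt a); split; rewrite ?sqrtr_ge0 ?sqr_sqrtr.
(* If [s ^ 2 <= t] then [s <= 1 + t]. *)
exists (1 + \sum_i D 0 i) => s [s_ge0]; rewrite AE.
move=> /(spectral_eigenvalue _ _ _ UU)[i si].
have Di_le : D 0 i <= \sum_i D 0 i.
  by rewrite (bigD1 i) //= lerDl sumr_ge0.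
nra.
Qed.

(** In a spectral basis of [A^T A] the claim reads
    [1 / (1 + d_i) >= 1 / (1 + sigma1 A ^ 2)]. *)
Lemma psd_resolvent_gram {m n} (A : 'M[R]_(m, n)) :
  psd (invmx (1%:M + A^T *m A) - ((1 + sigma1 A ^+ 2)^-1)%:M).
Proof.
have [U [D [UU D_ge0 AE]]] := psd_spectral _ (psd_gram A).
have U'U : U^T *m U = 1%:M by apply: mulmx1C.
have D_le i : D 0 i <= sigma1 A ^+ 2.
  apply: eigenvalue_gram_le; rewrite AE.
  by apply/(spectral_eigenvalue _ _ _ UU); exists i.
pose E : 'rV[R]_n := \row_i (1 + D 0 i)^-1.
have -> : invmx (1%:M + A^T *m A) = U^T *m diag_mx E *m U.
  have GE : 1%:M + A^T *m A = U^T *m (diag_mx (\row_i (1 + D 0 i))) *m U.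
    rewrite AE -U'U -[X in X *m _ + _]mulmx1 -mulmxDl -mulmxDr.
    congr (_ *m _ *m _).
    by apply/matrixP => i j; rewrite !mxE -mulrnDl.
  have G1 : (1%:M + A^T *m A) *m (U^T *m diag_mx E *m U) = 1%:M.
    rewrite GE !mulmxA -(mulmxA _ U) UU mulmx1 -(mulmxA _ _ (diag_mx _)).
    rewrite mulmx_diag -[RHS]U'U -[X in _ = X *m _]mulmx1; congr (_ *m _ *m _).
    rewrite -diag_const_mx; congr diag_mx; apply/rowP => i.
    rewrite !mxE divff //.
    by rewrite gt_eqF // ltr_wpDr.
  have [G_unit _] := mulmx1_unit G1.
  by rewrite -[RHS](mulKmx G_unit) G1 mulmx1.
have -> : (1 + sigma1 A ^+ 2)^-1%:M =
    U^T *m diag_mx (const_mx (1 + sigma1 A ^+ 2)^-1) *m U.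
  by rewrite diag_const_mx mul_mx_scalar -scalemxAl U'U scalemx1.
rewrite -mulmxBl -mulmxBr -linearB /=.
have /(psd_congr _ U^T) : psd (diag_mx (E - const_mx (1 + sigma1 A ^+ 2)^-1)).
  apply: psd_diag => i; rewrite !mxE subr_ge0 lef_pV2 ?posrE ?lerD2l //.
    by rewrite ltr_wpDr ?sqr_ge0.
  by rewrite ltr_wpDr.
by rewrite trmxK.
Qed.

Lemma psd_sub_scalar_unit {n} (A : 'M[R]_n) r : 0 < r -> psd (A - r%:M) ->
  A \in unitmx.
Proof.
move=> r_gt0 [_ A_ge]; rewrite -row_free_unit -kermx_eq0.
apply/eqP/row_matrixP => i.
have := row_mul i (kermx A) A; rewrite mulmx_ker !row0.
move: (row i (kermx A)) => v vA; apply/eqP; apply: contraT => /normsq_gt0 v_gt0.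
have := A_ge v^T; rewrite trmxK mulmxBr -vA sub0r mul_mx_scalar.
by rewrite mulNmx -scalemxAl 2!mxE oppr_ge0 leNgt mulr_gt0.
Qed.

(** * The Riccati equation *)

(** The Gram matrix of [R^(-1/2) H X] is [X^T Omega X], so that this is
    [psd_resolvent_gram]. *)
Lemma riccati_factor_ge {n d} (H : 'M[R]_(d, n)) (Robs : 'M[R]_d)
    (X : 'M[R]_n) :
  psd Robs -> Robs \in unitmx ->
  psd (invmx (1%:M + X^T *m precision H Robs *m X) -
       ((1 + sigma1 (invmx (sqrtmx Robs) *m H *m X) ^+ 2)^-1)%:M).
Proof.
move=> Rpsd Runit; have [[Ssym _] SS] := sqrtmxP _ Rpsd.
have Sunit : sqrtmx Robs \in unitmx.
  by move: Runit; rewrite -{1}SS unitmx_mul => /andP[].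
have -> : X^T *m precision H Robs *m X =
    (invmx (sqrtmx Robs) *m H *m X)^T *m (invmx (sqrtmx Robs) *m H *m X).
  rewrite /precision -{1}SS; set S := sqrtmx Robs in Ssym Sunit *.
  have -> : invmx (S *m S) = invmx S *m invmx S.
    have SSV : S *m S *m (invmx S *m invmx S) = 1%:M.
      by rewrite mulmxA mulmxK // mulmxV.
    by rewrite -[RHS](mulKmx (proj1 (mulmx1_unit SSV))) SSV mulmx1.
  by rewrite !trmx_mul trmx_inv Ssym !mulmxA.
exact: psd_resolvent_gram.
Qed.

Lemma cplxmx_psd_sqrt {n} (A : 'M[R]_n) : psd A ->
  exists Y : 'M[R[i]]_n, Y ^t* *m Y = cplxmx A.
Proof.
move=> /psd_sqrt_exists[B [[Bsym _] <-]]; exists (cplxmx B).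
have -> : (cplxmx B) ^t* = cplxmx B.
  by apply/matrixP => i j; rewrite !mxE -[in RHS]Bsym mxE; exact: conjc_real.
by rewrite /cplxmx map_mxM.
Qed.

(** Factoring [P = Y^* Y] and [Q + E = Z^* Z] turns the identity into the
    contraction hypothesis for [B = M^T], whence [v^* (Q + E) v = 0]; both terms
    are nonnegative, and [v^* Q v = 0] gives [Q v = 0]. *)
Lemma generalized_eigenvector_unexcited {n} (M P Q E : 'M[R]_n) (c : R) mu v :
  psd P -> psd Q -> psd E -> P = c *: (M *m P *m M^T) + Q + E ->
  1 <= c * cmod mu ^+ 2 ->
  generalized_eigenvector (cplxmx M^T) mu v -> cplxmx Q *m v = 0.
Proof.
move=> Ppsd Qpsd Epsd PE mu_ge1 [_ [k vk]].
have [Y YP] := cplxmx_psd_sqrt _ Ppsd.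
have [Z ZS] := cplxmx_psd_sqrt _ (psdD _ _ Qpsd Epsd).
have [F FQ] := cplxmx_psd_sqrt _ Qpsd.
have [G GE] := cplxmx_psd_sqrt _ Epsd.
have Zv : Z *m v = 0.
  apply: (nonstable_gen_eigen_unexcited (Y := Y) (Z := Z) (c := c%:C%C)
            _ _ _ _ vk).
  - have -> : `|mu| = (cmod mu)%:C%C by [].
    by rewrite -rmorphXn -rmorphM -(rmorph1 (real_complex R)) lecR.
  - have -> : (cplxmx M^T) ^t* = cplxmx M.
      by apply/matrixP => i j; rewrite !mxE; exact: conjc_real.
    rewrite YP ZS {1}PE -addrA.
    by rewrite /cplxmx map_mxD map_mxZ !map_mxM.
have QE0 : (v ^t* *m cplxmx Q *m v) 0 0 + (v ^t* *m cplxmx E *m v) 0 0 = 0.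
  have : v ^t* *m cplxmx (Q + E) *m v = 0.
    by rewrite -mulmxA -ZS -(mulmxA _ Z) Zv !mulmx0.
  rewrite /cplxmx map_mxD mulmxDr mulmxDl => /matrixP/(_ 0 0).
  by rewrite [LHS]mxE [RHS]mxE.
have quadE (X : 'M[R[i]]_n) :
    v ^t* *m (X ^t* *m X) *m v = (X *m v) ^t* *m (X *m v).
  by rewrite trCmx_mul !mulmxA.
move/eqP: QE0; rewrite -FQ -GE !quadE paddr_eq0 ?gram_ge0 //.
case/andP=> /eqP Fv0 _.
by rewrite -mulmxA (gram_eq0 _ Fv0) mulmx0.
Qed.

End PSD.

Theorem corollary1 (R : realType) (n d : nat) (hdn : (d <= n)%N)
    (M : 'M[R]_n) (hM : M \in unitmx) (H : 'M[R]_(d, n))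
    (Q : 'M[R]_n) (Robs : 'M[R]_d) (qinf qsup rinf rsup : R)
    (hqinf : 0 <= qinf)
    (hQinf : loewner_le qinf%:M Q) (hQsup : loewner_le Q qsup%:M)
    (hrinf : 0 < rinf)
    (hRinf : loewner_le rinf%:M Robs) (hRsup : loewner_le Robs rsup%:M)
    (disp : measure_display) (T : measurableType disp) (P : probability T R)
    (x w : nat -> 'I_n -> {RV P >-> R}) (y v : nat -> 'I_d -> {RV P >-> R})
    (hsys : linear_gaussian_system M H Q Robs x w y v)
    (Phat Xhat : 'M[R]_n) (hPhat : psd Phat) (hfact : Phat = Xhat *m Xhat^T)
    (hric : stable_riccati M H Q Robs Xhat Phat)
    (n0 : nat) (hn0 : nonneg_exponent_index M n0)
    (i : nat) (hi : (1 <= i <= n0)%N) (hexc : excited_exponent M Q i)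
    (hmin : forall j : nat, (1 <= j <= n0)%N -> excited_exponent M Q j ->
      (i <= j)%N) :
  expR (2 * lyapunov M i) /
    (1 + sigma1 (invmx (sqrtmx Robs) *m H *m Xhat) ^+ 2) < 1.
Proof.
have Qpsd : psd Q.
  by rewrite -[Q](subrK qinf%:M); apply: psdD => //; apply: psd_scalar.
have Rpsd : psd Robs.
  by rewrite -[Robs](subrK rinf%:M); apply: psdD => //; apply/psd_scalar/ltW.
have Runit := psd_sub_scalar_unit _ _ hrinf hRinf.
have [mu [u [mu_mod u_gen /eqP Qu_neq0]]] := hexc.
rewrite ltNge; apply/negP => c_ge1; apply: Qu_neq0.
set c := (1 + _)^-1 in c_ge1.
(* The surplus [E]: the bound [c] on the inner factor, conjugated by [M X]. *)
have Epsd := psd_congr _ (M *m Xhat) (riccati_factor_ge H _ Xhat Rpsd Runit).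
apply: (generalized_eigenvector_unexcited M Phat Q _ c) Epsd _ _ u_gen => //.
  rewrite -/c {1}hric hfact addrAC; congr (_ + _).
  rewrite mulmxBr mulmxBl mul_mx_scalar -scalemxAl trmx_mul !mulmxA.
  by rewrite addrC subrK.
by rewrite mu_mod -expRM_natl mulrC.
Qed.
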